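(* Let $T$ be a tree of order $n$ and let $D = D(T)$. Then the Seidel energy of $T$ satisfies $$\mathcal{E}(S(T)) \geq 2n - 6 + \sqrt{2(n-D)}.$$
   Context: All graphs are simple and finite. For a graph $G$ with vertex set $\{v_1,\dots,v_n\}$, the Seidel matrix $S(G)$ is the $n\times n$ matrix with zero diagonal, whose $(i,j)$ entry ($i\neq j$) is $-1$ if $v_i$ and $v_j$ are adjacent and $1$ otherwise. For a Hermitian matrix $A$, its energy $\mathcal{E}(A)$ is the sum of the absolute values of its eigenvalues; the Seidel energy of $G$ is $\mathcal{E}(S(G))$. For a tree $T$, $D(T)$ denotes the maximum, over vertices $w$ of $T$, of the number of leaves of $T$ adjacent to $w$. *)

(* Defs.v *)
From HB Require Import structures.
From mathcomp Require Import all_boot all_order all_algebra.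
From mathcomp Require Import algC.
Set Implicit Arguments. Unset Strict Implicit. Unset Printing Implicit Defensive.
Import Order.TTheory GRing.Theory Num.Theory.
Local Open Scope ring_scope.

Definition simple_graph (n : nat) (e : rel 'I_n) : Prop :=
  irreflexive e /\ symmetric e.

Definition is_tree (n : nat) (e : rel 'I_n) : Prop :=
  [/\ simple_graph e, (0 < n)%N,
      (forall x y : 'I_n, connect e x y) &
      (forall c : seq 'I_n, (3 <= size c)%N -> ~~ ucycleb e c)].

Definition seidel (n : nat) (e : rel 'I_n) : 'M[algC]_n :=
  \matrix_(i, j) (if i == j then 0 else if e i j then -1 else 1).

(* Eigenvalues (with multiplicity) of a square complex matrix: the roots of
   its characteristic polynomial, which splits over the algebraically closed
   field algC. *)
Definition eigenvalues (n : nat) (A : 'M[algC]_n) : seq algC :=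
  sval (closed_field_poly_normal (char_poly A)).

Definition energy (n : nat) (A : 'M[algC]_n) : algC :=
  \sum_(z <- eigenvalues A) `|z|.

Definition seidel_energy (n : nat) (e : rel 'I_n) : algC := energy (seidel e).

Definition degree (n : nat) (e : rel 'I_n) (v : 'I_n) : nat := #|[set u | e v u]|.
Definition is_leaf (n : nat) (e : rel 'I_n) (v : 'I_n) : bool := degree e v == 1%N.
Definition maxLeafNbr (n : nat) (e : rel 'I_n) : nat :=
  \max_(w : 'I_n) #|[set u | e w u && is_leaf e u]|.

(* Main.v *)
Require Import Defs.
From HB Require Import structures.
From mathcomp Require Import all_boot all_order all_algebra.
From mathcomp Require Import algC spectral sesquilinear zify ring lra.
Import Order.TTheory GRing.Theory Num.Theory.
Local Open Scope ring_scope.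
Local Open Scope sesquilinear_scope.

(* Write [A] for the adjacency matrix, [S = J - (2A + 1)], and let [l_1 >= l_2 >= ...]
   be the eigenvalues of [A]. Since [tr S = 0], the energy is at least [-2 tr (S X)]
   for every orthogonal projector [X]. Taking for [X] the spectral projector of
   [2A + 1] on its positive part, cut down by one dimension to be orthogonal to the
   all-ones vector, and using that the spectrum of a bipartite graph is symmetric,
   gives  E(S) / 2 >= n - 2 + sum_(i >= 2) max(2 l_i - 1, 0).
   By interlacing, the sum can be bounded below on any induced subgraph, after
   giving up its largest eigenvalue. With [f := E(S) / 2 - n + 3]:
   - an induced forest of stars with [k] centres and [N] edges outside a largest
     star gives [4 N <= f^2] and [k <= f];
   - an induced double star with [k] leaves on each side gives
     [sqrt (1 + 4 k) - 1 <= f].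
   Root the tree at a vertex [w] of maximum degree. The vertices of depth [i] mod 3
   together with their parents form an induced star forest for each [i]; the star
   of a nonroot vertex that must be given up is bounded by pairing it with the star
   of [w]. Adding up, [n] minus the number of leaves at [w] is at most [2 f^2]. *)

(** * Trace norm and projectors *)

Section TraceNorm.
Variable n : nat.
Implicit Types A S X Y U : 'M[algC]_n.

Lemma trmxC_mul (m p q : nat) (A : 'M[algC]_(m, p)) (B : 'M[algC]_(p, q)) :
  (A *m B) ^t* = B ^t* *m A ^t*.
Proof. by rewrite trmx_mul map_mxM. Qed.

Lemma char_poly_unitary_conj U (d : 'rV[algC]_n) :
  U \is unitarymx ->
  char_poly (U ^t* *m diag_mx d *m U) = \prod_(i < n) ('X - (d 0 i)%:P).
Proof.
move=> Uu; have Uun := unitarymx_unit Uu.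
have UU : U ^t* *m U = 1%:M by rewrite -invmx_unitary // mulVmx.
have -> : \prod_(i < n) ('X - (d 0 i)%:P) = char_poly (diag_mx d).
  rewrite char_poly_trig ?diag_mx_is_trig //.
  by apply: eq_bigr => i _; rewrite mxE eqxx.
rewrite /char_poly /char_poly_mx.
rewrite !map_mxM /=.
set P := map_mx _ (U ^t*); set Q := map_mx _ U; set D := map_mx _ (diag_mx d).
have PQ : P *m Q = 1%:M by rewrite -map_mxM UU map_mx1.
have -> : 'X%:M - P *m D *m Q = P *m ('X%:M - D) *m Q.
  by rewrite mulmxBr mulmxBl scalar_mxC -(mulmxA 'X%:M) PQ mulmx1.
by rewrite !det_mulmx mulrAC -det_mulmx PQ det1 mul1r.
Qed.

Lemma herm_spectral A : A ^t* = A ->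
  exists2 U, U \is unitarymx & exists2 d : 'rV[algC]_n,
    (forall i, d 0 i \is Num.real) & A = U ^t* *m diag_mx d *m U.
Proof.
move=> hA; have Ah : A \is hermsymmx.
  by apply/is_hermitianmxP; rewrite expr0 scale1r.
exists (spectralmx A); first exact: spectral_unitarymx.
exists (spectral_diag A).
  by move=> i; have /mxOverP -> := hermitian_spectral_diag_real Ah.
by rewrite -invmx_unitary ?spectral_unitarymx //;
   apply/orthomx_spectralP/hermitian_normalmx.
Qed.

(** The chosen roots come in an unknown order; unique factorisation matches them with the diagonal
    up to permutation. *)
Lemma energy_unitary_conj U (d : 'rV[algC]_n) : U \is unitarymx ->
  energy (U ^t* *m diag_mx d *m U) = \sum_i `|d 0 i|.
Proof.
move=> Uu; rewrite /energy /eigenvalues; case: closed_field_poly_normal => r /=.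
rewrite (monicP (char_poly_monic _)) scale1r char_poly_unitary_conj // => E.
have/prod_XsubC_eq pr : \prod_(z <- [seq d 0 i | i : 'I_n]) ('X - z%:P) =
    \prod_(z <- r) ('X - z%:P).
  by rewrite -E big_map big_enum.
by rewrite -(perm_big _ pr) /= big_map big_enum.
Qed.

Lemma unitarymx_entry_le1 U i j : U \is unitarymx -> `|U i j| <= 1.
Proof.
move/unitarymxP/matrixP/(_ i i); rewrite !mxE eqxx mulr1n => E.
rewrite -(@ler_pXn2r _ 2) ?nnegrE // expr1n -[leRHS]E (bigD1 j) //= !mxE -normCK.
by rewrite lerDl sumr_ge0 // => k _; rewrite !mxE -normCK exprn_ge0.
Qed.

(** After diagonalising [S], the trace is a sum of eigenvalues times diagonal entries of a unitary
    conjugate of [Y], each of modulus at most 1. *)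
Lemma energy_ge_trace S Y : S ^t* = S -> Y \is unitarymx ->
  `|\tr (S *m Y)| <= energy S.
Proof.
move=> /herm_spectral[U Uu [d _ ->]] Yu; rewrite energy_unitary_conj //.
rewrite -!mulmxA mxtrace_mulC -!mulmxA.
have Zu : U *m (Y *m U ^t*) \is unitarymx.
  by rewrite !mul_unitarymx // trmxC_unitary.
set Z := U *m _ in Zu *.
rewrite /mxtrace; apply: le_trans (ler_norm_sum _ _ _) _.
apply: ler_sum => i _; rewrite mul_diag_mx mxE normrM.
by rewrite ler_piMr // unitarymx_entry_le1.
Qed.

Lemma herm_top_eigen A : (0 < n)%N -> A ^t* = A ->
  exists lam, exists p : 'rV[algC]_n,
  [/\ p *m p ^t* = 1%:M, p *m A = lam *: p &
   forall x : 'rV_n, (x *m A *m x ^t*) 0 0 <= lam * (x *m x ^t*) 0 0].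
Proof.
move=> n0 /herm_spectral[U Uu [d dr ->]].
have UU : U ^t* *m U = 1%:M.
  by rewrite -invmx_unitary // mulVmx ?unitarymx_unit.
have := @real_arg_maxP algC _ (Ordinal n0) xpredT (d 0) isT (fun i _ => dr i).
case=> i _ imax; exists (d 0 i), (row i U); split.
- rewrite rowE trmxC_mul mulmxA -[X in X *m _](mulmxA) (unitarymxP Uu) mulmx1.
  apply/matrixP => a b; rewrite !ord1 !mxE (bigD1 i) //= big1 ?addr0 => [|j ji].
    by rewrite !mxE !eqxx conjC1 mulr1.
  by rewrite !mxE (negPf ji) andbF mul0r.
- rewrite !mulmxA -row_mul (unitarymxP Uu) row1.
  rewrite rowE scalemxAl; congr (_ *m _).
  apply/rowP => j; rewrite mul_mx_diag !mxE eqxx /=.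
  by case: eqP => [->|]; rewrite ?mulr1 ?mul1r ?mulr0 ?mul0r.
move=> x; set y := x *m U ^t*.
have -> : x *m (U ^t* *m diag_mx d *m U) *m x ^t* = y *m diag_mx d *m y ^t*.
  by rewrite trmxC_mul trmxCK !mulmxA.
have -> : x *m x ^t* = y *m y ^t*.
  by rewrite trmxC_mul trmxCK !mulmxA -[_ *m _ *m U]mulmxA UU mulmx1.
rewrite !mxE mulr_sumr; apply: ler_sum => j _.
rewrite mul_mx_diag !mxE mulrAC -normCK mulrC ler_wpM2r ?exprn_ge0 //.
exact: imax.
Qed.

End TraceNorm.

Section Projectors.
Variable n : nat.
Implicit Types X U : 'M[algC]_n.
Implicit Types y v p : 'rV[algC]_n.

Definition is_proj X := X ^t* = X /\ X *m X = X.

Lemma trmxCD (m q : nat) (A B : 'M[algC]_(m, q)) : (A + B) ^t* = A ^t* + B ^t*.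
Proof. by rewrite linearD map_mxD. Qed.

Lemma trmxCN (m q : nat) (A : 'M[algC]_(m, q)) : (- A) ^t* = - A ^t*.
Proof. by rewrite linearN map_mxN. Qed.

Lemma is_proj_compl X : is_proj X -> is_proj (1%:M - X).
Proof.
case=> hX X2; split; first by rewrite trmxCD trmxCN hX trmx1 map_mx1.
by rewrite mulmxBl mul1mx mulmxBr mulmx1 X2 subrr subr0.
Qed.

Lemma is_proj_sub X y : is_proj X -> y *m X = y -> y *m y ^t* *m y = y ->
  is_proj (X - y ^t* *m y).
Proof.
move=> [hX X2] yX yy.
have Xy : X *m y ^t* = y ^t* by rewrite -{1}hX -trmxC_mul yX.
split; first by rewrite trmxCD trmxCN trmxC_mul trmxCK hX.
have e3 : y ^t* *m y *m (y ^t* *m y) = y ^t* *m y by rewrite -mulmxA (mulmxA y) yy.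
by rewrite mulmxBl !mulmxBr X2 e3 mulmxA Xy -mulmxA yX subrr subr0.
Qed.

Lemma is_proj_add X y : is_proj X -> y *m X = 0 -> y *m y ^t* *m y = y ->
  is_proj (X + y ^t* *m y).
Proof.
move=> [hX X2] yX yy.
have Xy : X *m y ^t* = 0 by rewrite -{1}hX -trmxC_mul yX trmx0 map_mx0.
split; first by rewrite trmxCD trmxC_mul trmxCK hX.
have e3 : y ^t* *m y *m (y ^t* *m y) = y ^t* *m y by rewrite -mulmxA (mulmxA y) yy.
by rewrite mulmxDl !mulmxDr X2 e3 mulmxA Xy -mulmxA yX mul0mx mulmx0 addr0 add0r.
Qed.

Lemma is_proj_conj X U : is_proj X -> U ^t* = U -> U *m U = 1%:M ->
  is_proj (U *m X *m U).
Proof.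
move=> [hX X2] hU U2; split; first by rewrite !trmxC_mul hX hU mulmxA.
by rewrite !mulmxA -(mulmxA _ U U) U2 mulmx1 -(mulmxA _ X X) X2.
Qed.

(** This unitary, put into [energy_ge_trace], yields the bound -2 tr (S X). *)
Lemma is_proj_reflection X : is_proj X -> 1%:M - X *+ 2 \is unitarymx.
Proof.
move=> [hX X2]; apply/unitarymxP.
rewrite mulr2n trmxCD trmxCN trmxCD hX trmx1 map_mx1.
rewrite mulmxBl mul1mx !mulmxBr !mulmx1 !mulmxDr !mulmxDl !X2.
by rewrite opprB addrK subrK.
Qed.

(** [y] is the normalised projection of [v] onto the range of [X], or 0 when that projection
    vanishes. *)
Lemma is_proj_peel X v : is_proj X -> exists y,
  [/\ is_proj (X - y ^t* *m y), v *m (X - y ^t* *m y) = 0, y *m X = y &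
      (y *m y ^t*) 0 0 \in [:: 0; 1]].
Proof.
move=> pX; have [hX X2] := pX; set z := v *m X.
have zX : z *m X = z by rewrite /z -mulmxA X2.
have [z0|zN0] := eqVneq z 0.
  exists 0; rewrite trmx0 map_mx0 mulmx0 subr0 !mul0mx; split => //.
  by rewrite mxE inE eqxx.
set N := (z *m z ^t*) 0 0.
have N0 : 0 < N by have := dotmx_is_dotmx zN0; rewrite dotmxE.
have zz : z *m z ^t* = N%:M by apply/matrixP => i j; rewrite !ord1 [RHS]mxE mulr1n.
have sN0 : sqrtC N != 0 by rewrite sqrtC_eq0 gt_eqF.
have sr : (sqrtC N)^-1 ^* = (sqrtC N)^-1.
  by apply: CrealP; rewrite realV ger0_real // sqrtC_ge0 ltW.
set a := (sqrtC N)^-1 in sr.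
have aaN : a * a * N = 1.
  by rewrite -[N]sqrtCK expr2 /a mulrACA mulVf // mulr1.
exists (a *: z).
have yE : (a *: z) ^t* = a *: z ^t* by rewrite linearZ map_mxZ /= sr.
have yy : (a *: z) *m (a *: z) ^t* = 1%:M.
  by rewrite yE -scalemxAl -scalemxAr zz !scale_scalar_mx mulrA aaN.
have yX : (a *: z) *m X = a *: z by rewrite -scalemxAl zX.
split=> //; last by rewrite yy mxE eqxx mulr1n !inE eqxx orbT.
  by apply: is_proj_sub => //; rewrite yy mul1mx.
have Xz : X *m z ^t* = z ^t* by rewrite -{1}hX -trmxC_mul zX.
have vz : v *m z ^t* = N%:M by rewrite -Xz mulmxA -/z zz.
rewrite mulmxBr -/z mulmxA yE -!scalemxAr -!scalemxAl vz mul_scalar_mx.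
by rewrite !scalerA aaN scale1r subrr.
Qed.

End Projectors.

Lemma mxtrace_mul_rank1 (n : nat) (M : 'M[algC]_n) (y : 'rV[algC]_n) :
  \tr (M *m (y ^t* *m y)) = (y *m M *m y ^t*) 0 0.
Proof.
by rewrite mulmxA mxtrace_mulC mulmxA /mxtrace big_ord_recl big_ord0 addr0.
Qed.

(** * The energy bound from a compression of 2A - 1 *)

Definition adj (n : nat) (e : rel 'I_n) : 'M[algC]_n := \matrix_(i, j) (e i j)%:R.

Definition shifted_adj (n : nat) (e : rel 'I_n) : 'M[algC]_n :=
  2 *: adj _ e - 1%:M.

Section SeidelBound.
Variables (n : nat) (e : rel 'I_n) (chi : 'I_n -> bool).
Hypothesis n_gt0 : (0 < n)%N.
Hypothesis e_irr : irreflexive e.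
Hypothesis e_sym : symmetric e.
Hypothesis chiP : forall x y, e x y -> chi x != chi y.

Let A := adj _ e.
Let G := shifted_adj _ e.
Let H : 'M[algC]_n := 2 *: A + 1%:M.
Let sgn : 'M[algC]_n := diag_mx (\row_i (-1) ^+ chi i).

Let A_herm : A ^t* = A.
Proof. by apply/matrixP => i j; rewrite !mxE e_sym conjC_nat. Qed.

Lemma seidel_herm : (seidel e) ^t* = seidel e.
Proof.
apply/matrixP => i j; rewrite !mxE eq_sym (e_sym i).
by case: eqP => _; last case: (e j i); rewrite ?rmorphN ?rmorph1 ?rmorph0.
Qed.

Let seidelE : seidel e = (const_mx 1 : 'rV_n)^t* *m const_mx 1 - H.
Proof.
apply/matrixP => i j; rewrite !mxE big_ord_recl big_ord0 !mxE conjC1 mulr1 addr0.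
have [->|ij] := eqVneq i j; first by rewrite e_irr mulr0n mulr1n; ring.
by case: (e i j); rewrite ?mulr1n !mulr0n; ring.
Qed.

Let sgn_herm : sgn ^t* = sgn.
Proof.
rewrite tr_diag_mx map_diag_mx; congr diag_mx; apply/rowP => i.
by rewrite !mxE rmorph_sign.
Qed.

Let sgn2 : sgn *m sgn = 1%:M.
Proof.
rewrite /sgn mul_diag_mx; apply/matrixP => i j; rewrite !mxE.
by case: eqP => [->|_]; rewrite ?mulr0 // !mulr1n -expr2 sqrr_sign.
Qed.

(** Changing signs on one colour class negates [A]: this is the symmetry of a bipartite spectrum. *)
Let sgnH : sgn *m H *m sgn = - G.
Proof.
rewrite /G /shifted_adj opprB mulmxDr mulmxDl mulmx1 sgn2 addrC; congr (_ + _).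
rewrite -scalemxAr -scalemxAl -scalerN; congr (_ *: _).
apply/matrixP => i j; rewrite mul_diag_mx mul_mx_diag !mxE.
case eij: (e i j); rewrite ?mulr0 ?mul0r ?oppr0 //.
by have := chiP _ _ eij; case: (chi i); case: (chi j) => // _; ring.
Qed.

(** The test projector is the complement of a sign-conjugated one, which turns the trace of [H] into
    n plus a trace of [G]. Inserting the top eigenvector [p] earns 2 lam - 1 and costs at most [B];
    removing the all-ones direction costs at most 2 lam + 1. Hence the loss 2 + [B], free of
    [lam]. *)
Lemma seidel_energy_ge (V : 'M[algC]_n) (B : algC) :
  V *m V ^t* *m V = V -> 0 <= B ->
  (forall c : 'rV_n,
     (c *m (V *m G *m V ^t*) *m c ^t*) 0 0 <= B * (c *m c ^t*) 0 0) ->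
  2 * (n%:R - 2 + \tr (V *m G *m V ^t*) - B) <= seidel_energy e.
Proof.
move=> VV B0 MB.
have [lam [p [pp pA Amax]]] := herm_top_eigen _ _ n_gt0 A_herm.
have lam0 : 0 <= lam.
  have := Amax (delta_mx 0 (Ordinal n_gt0)).
  rewrite -rowE mxE (bigD1 (Ordinal n_gt0)) //= big1 => [|j jn]; last first.
    by rewrite !mxE (negPf jn) andbF conjC0 mulr0.
  rewrite !mxE e_irr mul0r addr0 (bigD1 (Ordinal n_gt0)) //= big1 => [|j jn].
    by rewrite !mxE !eqxx conjC1 mulr1 addr0 mulr1.
  by rewrite !mxE (negPf jn) andbF conjC0 mulr0.
(* Replacing the direction of [p] in the row space of [V] by [p] itself makes
   the term [2 lam - 1] appear; it pays for removing the all-ones direction later. *)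
pose XU := V ^t* *m V.
have pXU : is_proj _ XU.
  split; first by rewrite trmxC_mul trmxCK.
  by rewrite /XU mulmxA -(mulmxA _ V) -(mulmxA (V ^t*)) VV.
have [y' [pX1 pX10 y'X y'y']] := is_proj_peel _ _ p pXU.
have pX' := is_proj_add _ _ _ pX1 pX10 (etrans (congr1 (mulmx^~ p) pp) (mul1mx p)).
set X' := XU - _ + _ in pX'.
have pP := is_proj_compl _ _ (is_proj_conj _ _ _ pX' sgn_herm sgn2).
set P := 1%:M - _ in pP.
have [y [pX oneX yP yy]] := is_proj_peel _ _ (const_mx 1) pP.
set X := P - _ in pX oneX.
(* [X] annihilates the all-ones vector, so the rank-one part of the Seidel matrix drops out. *)
have trX : \tr (seidel e *m X) = - \tr (H *m X).
  rewrite seidelE mulmxBl linearB /= -mulmxA oneX mulmx0 linear0.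
  by rewrite sub0r.
have trS : \tr (seidel e) = 0 by rewrite /mxtrace big1 // => i _; rewrite mxE eqxx.
have yH : (y *m H *m y ^t*) 0 0 <= 2 * lam + 1.
  rewrite mulmxDr mulmx1 mulmxDl mxE -scalemxAr -scalemxAl mxE.
  have := Amax y; move: yy; rewrite !inE => /orP[]/eqP->.
    rewrite mulr0 addr0 => h.
    apply: le_trans (_ : 2 * 0 <= _); first by rewrite ler_wpM2l.
    by rewrite mulr0 addr_ge0 // mulr_ge0.
  by rewrite mulr1 => h; rewrite lerD2r ler_wpM2l.
have pG : (p *m G *m p ^t*) 0 0 = 2 * lam - 1.
  rewrite mulmxBr mulmx1 -scalemxAr pA mulmxBl -!scalemxAl pp !mxE.
  by rewrite eqxx mulr1n !mulr1.
(* [y'] lies in the row space of [V], so the hypothesis on the compression controls its quadratic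
   form. *)
have y'G : (y' *m G *m y' ^t*) 0 0 <= B.
  have {1 2}<- := y'X.
  have -> : y' *m XU *m G *m (y' *m XU) ^t* =
     (y' *m V ^t*) *m (V *m G *m V ^t*) *m (y' *m V ^t*) ^t*.
    by rewrite !trmxC_mul !trmxCK !mulmxA.
  apply: le_trans (MB _) _.
  rewrite trmxC_mul trmxCK mulmxA -(mulmxA y') y'X.
  by move: y'y'; rewrite !inE => /orP[]/eqP->; rewrite ?mulr0 ?mulr1.
have trHX : \tr (H *m X) = n%:R + \tr (V *m G *m V ^t*)
    - (y' *m G *m y' ^t*) 0 0 + (2 * lam - 1) - (y *m H *m y ^t*) 0 0.
  rewrite /X mulmxBr linearB /= mxtrace_mul_rank1; congr (_ - _).
  rewrite /P mulmxBr mulmx1 linearB /= mulmxA mxtrace_mulC !mulmxA sgnH.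
  rewrite mulNmx linearN opprK.
  have -> : \tr H = n%:R.
    rewrite linearD linearZ /= mxtrace1 [X in _ * X]big1 ?mulr0 ?add0r // => i _.
    by rewrite mxE e_irr.
  rewrite /X' mulmxDr mulmxBr linearD linearB /= !mxtrace_mul_rank1 pG.
  by rewrite /XU mulmxA mxtrace_mulC mulmxA !addrA.
have := energy_ge_trace _ _ _ seidel_herm (is_proj_reflection _ _ pX).
apply: le_trans.
have -> : \tr (seidel e *m (1%:M - X *+ 2)) = 2 * \tr (H *m X).
  rewrite mulmxBr mulmx1 linearB /= trS mulr2n mulmxDr linearD /= trX.
  by ring.
apply: le_trans (_ : 2 * \tr (H *m X) <= _); last first.
  apply: real_ler_norm; rewrite realM ?realn //.
  apply/CrealP; have [hX _] := pX.
  have hH : H ^t* = H by rewrite trmxCD linearZ map_mxZ /= conjC_nat A_herm trmx1 map_mx1.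
  have <- : \tr ((H *m X) ^t*) = (\tr (H *m X))^*.
    by rewrite /mxtrace rmorph_sum; apply: eq_bigr => i _; rewrite !mxE.
  by rewrite trmxC_mul hX hH mxtrace_mulC.
rewrite ler_wpM2l // trHX -subr_ge0.
set t := \tr _; set a := (y' *m _ *m _) 0 0; set b := (y *m _ *m _) 0 0.
have -> : n%:R + t - a + (2 * lam - 1) - b - (n%:R - 2 + t - B) =
  (B - a) + (2 * lam + 1 - b) by ring.
by rewrite addr_ge0 // subr_ge0.
Qed.

End SeidelBound.

(** * Induced stars *)

(** Twice this is the energy minus 2n - 6, so for nonnegative [excess] the theorem reads n - D <= 2
    [excess]^2. *)
Definition excess (n : nat) (e : rel 'I_n) : algC :=
  seidel_energy e / 2 - n%:R + 3.

Section Stars.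
Variables (n : nat) (e : rel 'I_n) (chi : 'I_n -> bool).
Hypothesis n_gt0 : (0 < n)%N.
Hypothesis e_irr : irreflexive e.
Hypothesis e_sym : symmetric e.
Hypothesis chiP : forall x y, e x y -> chi x != chi y.

Lemma excess_ge (V : 'M[algC]_n) (B : algC) :
  V *m V ^t* *m V = V -> 0 <= B ->
  (forall c : 'rV_n,
     (c *m (V *m shifted_adj _ e *m V ^t*) *m c ^t*) 0 0 <= B * (c *m c ^t*) 0 0) ->
  1 + \tr (V *m shifted_adj _ e *m V ^t*) - B <= excess _ e.
Proof.
move=> VV B0 MB.
have := seidel_energy_ge _ _ _ n_gt0 e_irr e_sym chiP _ _ VV B0 MB.
set t := \tr _ => h; rewrite /excess -(@ler_pM2l _ 2) //.
rewrite [leRHS](_ : _ = seidel_energy e + (6 - 2 * n%:R)); last by field.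
by rewrite -lerBlDr; apply: le_trans h; rewrite le_eqVlt; apply/orP; left; apply/eqP; ring.
Qed.

Section Weights.
Variables (C : {set 'I_n}) (L : 'I_n -> {set 'I_n}) (p q : 'I_n -> algC).
Hypothesis edgeL : forall c x, c \in C -> x \in L c -> e c x.
Hypothesis sepL : forall c c' x, c \in C -> c' \in C -> c != c' -> x \in L c ->
  [/\ x != c', x \notin L c', ~~ e c' x & forall x', x' \in L c' -> ~~ e x x'].
Hypothesis pR : forall c, (p c)^* = p c.
Hypothesis qR : forall c, (q c)^* = q c.
Hypothesis norm1 : forall c, c \in C -> p c * p c + #|L c|%:R * (q c * q c) = 1.

Let wt c x : algC := if c \in C then (x == c)%:R * p c + (x \in L c)%:R * q c else 0.

(** Rows outside [C] vanish, which keeps the matrix square; the rows in [C] will be orthonormal,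
    making it a partial isometry. *)
Definition star_mx : 'M[algC]_n := \matrix_(c, x) wt c x.

Let star_sum c (F : 'I_n -> algC) : c \in C ->
  \sum_x wt c x * F x = p c * F c + q c * \sum_(x in L c) F x.
Proof.
move=> cC; rewrite /wt cC.
under eq_bigr do rewrite mulrDl.
rewrite big_split /=; congr (_ + _).
  rewrite (bigD1 c) //= big1 => [|x /negPf->]; last by rewrite !mul0r.
  by rewrite eqxx mul1r addr0.
rewrite mulr_sumr [RHS]big_mkcond /=; apply: eq_bigr => x _.
by case: (x \in L c); rewrite ?mul1r ?mul0r.
Qed.

Let wtC c x : (wt c x)^* = wt c x.
Proof.
by rewrite /wt; case: ifP => _; rewrite ?conjC0 // rmorphD !rmorphM !rmorph_nat /= pR qR.
Qed.

Let wt_centre c : c \in C -> wt c c = p c.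
Proof.
move=> cC; rewrite /wt cC eqxx mul1r; case: (boolP (c \in L c)) => [h|_].
  by have := edgeL _ _ cC h; rewrite e_irr.
by rewrite mul0r addr0.
Qed.

Let wt_leaf c x : c \in C -> x \in L c -> wt c x = q c.
Proof.
move=> cC xL; rewrite /wt cC xL mul1r; case: eqP => [h|_].
  by have := edgeL _ _ cC xL; rewrite h e_irr.
by rewrite mul0r add0r.
Qed.

Let wt_other_centre c c' : c \in C -> c' \in C -> c != c' -> wt c' c = 0.
Proof.
move=> cC c'C cc'; rewrite /wt c'C (negPf cc') mul0r add0r.
case: (boolP (c \in L c')) => [h|_]; last by rewrite mul0r.
by have [] := sepL c' c c c'C cC _ h; rewrite ?eqxx // eq_sym.
Qed.

Let wt_other_leaf c c' x : c \in C -> c' \in C -> c != c' -> x \in L c -> wt c' x = 0.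
Proof.
move=> cC c'C cc' xL; rewrite /wt c'C.
by have [/negPf-> /negPf-> _ _] := sepL _ _ _ cC c'C cc' xL; rewrite !mul0r addr0.
Qed.

Lemma star_mx_gram : star_mx *m star_mx ^t* = diag_mx (\row_c (c \in C)%:R).
Proof.
apply/matrixP => c c'; rewrite !mxE.
under eq_bigr do rewrite !mxE wtC.
case cC: (c \in C); last first.
  rewrite big1 => [|x _]; first by case: eqP.
  by rewrite /wt cC mul0r.
rewrite star_sum //; have [<-|cc'] := eqVneq c c'.
  rewrite wt_centre // (eq_bigr (fun=> q c)) => [|x]; last exact: wt_leaf.
  by rewrite sumr_const -[_ *+ #|_|]mulr_natl mulrCA norm1 ?mulr1n.
case c'C: (c' \in C); last first.
  by rewrite big1 /wt => [|x _]; rewrite ?c'C // !mulr0 addr0.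
rewrite wt_other_centre // big1 => [|x xL]; first by rewrite !mulr0 addr0.
exact: (wt_other_leaf c).
Qed.

Lemma star_mx_proj : star_mx *m star_mx ^t* *m star_mx = star_mx.
Proof.
rewrite star_mx_gram mul_diag_mx; apply/matrixP => c x; rewrite !mxE /wt.
by case: ifP => _; rewrite ?mulr0 // mul1r.
Qed.

(** The 2-colouring forbids edges between leaves of one star, and [sepL] forbids edges between two
    stars other than centre to centre. *)
Lemma star_mx_adj : star_mx *m adj _ e *m star_mx ^t* = \matrix_(c, c')
  if (c \in C) && (c' \in C) then
    if c == c' then 2 * #|L c|%:R * (p c * q c) else (e c c')%:R * (p c * p c')
  else 0.
Proof.
have E c c' : (star_mx *m adj _ e *m star_mx ^t*) c c' =
   \sum_x wt c x * \sum_x' wt c' x' * (e x x')%:R.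
  rewrite -mulmxA mxE; apply: eq_bigr => x _; rewrite !mxE; congr (_ * _).
  by apply: eq_bigr => x' _; rewrite !mxE wtC mulrC.
apply/matrixP => c c'; rewrite E mxE.
case cC: (c \in C); last by rewrite big1 // => x _; rewrite /wt cC mul0r.
case c'C: (c' \in C); last first.
  rewrite big1 // => x _; rewrite big1 ?mulr0 // => x' _.
  by rewrite /wt c'C mul0r.
rewrite star_sum // star_sum //=.
under [X in _ + _ * X]eq_bigr do rewrite star_sum //.
have [<-|cc'] := eqVneq c c'.
  rewrite e_irr mulr0 add0r (eq_bigr (fun=> 1)) => [|x xL]; last by rewrite edgeL.
  rewrite (eq_bigr (fun=> p c)) => [|x xL].
    by rewrite !sumr_const -[p c *+ _]mulr_natl; ring.
  rewrite e_sym edgeL // big1 ?mulr0 ?addr0 ?mulr1 // => x' x'L.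
  have h1 := chiP _ _ (edgeL _ _ cC xL); have h2 := chiP _ _ (edgeL _ _ cC x'L).
  case exx' : (e x x') => //; have := chiP _ _ exx'.
  by move: h1 h2; case: (chi c); case: (chi x); case: (chi x').
have c'c : c' != c by rewrite eq_sym.
rewrite big1 => [|x xL]; last first.
  by have [_ _ /negPf-> _] := sepL c' c x c'C cC c'c xL.
rewrite big1 => [|x xL]; first by ring.
have [_ _ h1 h2] := sepL c c' x cC c'C cc' xL.
rewrite e_sym (negPf h1) big1 => [|x' x'L]; first by rewrite !mulr0 addr0.
by rewrite (negPf (h2 _ x'L)).
Qed.

Lemma star_mx_shifted_adj : star_mx *m shifted_adj _ e *m star_mx ^t* =
  \matrix_(c, c')
  if (c \in C) && (c' \in C) then
    if c == c' then 4 * #|L c|%:R * (p c * q c) - 1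
    else 2 * (e c c')%:R * (p c * p c')
  else 0.
Proof.
rewrite /shifted_adj mulmxBr mulmx1 mulmxBl -scalemxAr -scalemxAl.
rewrite star_mx_adj star_mx_gram; apply/matrixP => c c'; rewrite !mxE.
have [<-|cc'] := eqVneq c c'; case: (c \in C) => /=.
- by rewrite !mulr1n; ring.
- by rewrite !mulr0n mulr0 subr0.
- by case: (c' \in C); rewrite mulr0n; ring.
by rewrite !mulr0n mulr0 subr0.
Qed.

End Weights.

Lemma quad_form_diag (d : 'I_n -> algC) (M : 'M[algC]_n) (B : algC) :
  (forall c c', M c c' = if c == c' then d c else 0) -> (forall c, d c <= B) ->
  forall v : 'rV_n, (v *m M *m v ^t*) 0 0 <= B * (v *m v ^t*) 0 0.
Proof.
move=> ME dB v; have -> : M = diag_mx (\row_c d c).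
  by apply/matrixP => c c'; rewrite ME !mxE; case: eqP => [->|].
rewrite mul_mx_diag !mxE mulr_sumr; apply: ler_sum => c _; rewrite !mxE.
by rewrite mulrAC -normCK mulrC ler_wpM2r ?exprn_ge0.
Qed.

(** Testing each star on its top eigenvector makes the compression diagonal, as distinct stars are
    not adjacent. [B] is the entry of the largest star, so [c0] cancels from the trace. *)
Lemma star_forest_excess (L : 'I_n -> {set 'I_n}) (c0 : 'I_n) :
  (forall c x, x \in L c -> e c x) ->
  (forall c c', L c != set0 -> L c' != set0 -> c != c' -> ~~ e c c') ->
  (forall c c' x, L c' != set0 -> c != c' -> x \in L c ->
     [/\ x != c', x \notin L c', ~~ e c' x & forall x', x' \in L c' -> ~~ e x x']) ->
  L c0 != set0 -> (forall c, (#|L c| <= #|L c0|)%N) ->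
  1 + \sum_(c | (L c != set0) && (c != c0)) (2 * sqrtC #|L c|%:R - 1) <= excess _ e.
Proof.
move=> edgeL cenL sepL L0 Lmax.
pose C := [set c | L c != set0].
pose r c : algC := sqrtC #|L c|%:R.
have r0 c : c \in C -> r c != 0.
  by rewrite inE sqrtC_eq0 pnatr_eq0 cards_eq0.
have r2 c : #|L c|%:R = r c * r c by rewrite -expr2 sqrtCK.
have rR c : (r c)^* = r c by apply/CrealP; rewrite ger0_real // sqrtC_ge0.
pose t : algC := sqrtC 2.
have t2 : t * t = 2 by rewrite -expr2 sqrtCK.
have t0 : t != 0 by rewrite sqrtC_eq0 pnatr_eq0.
have tR : t^* = t by apply/CrealP; rewrite ger0_real // sqrtC_ge0.
(* Weights 1/sqrt 2 at the centre and 1/sqrt (2 l) on each of l leaves form the unit eigenvector of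
   the star for the eigenvalue sqrt l. *)
pose p (c : 'I_n) := t^-1; pose q c := (t * r c)^-1.
have pR c : (p c)^* = p c by rewrite /p fmorphV /= tR.
have qR c : (q c)^* = q c by rewrite /q fmorphV rmorphM /= tR rR.
have nm c : c \in C -> p c * p c + #|L c|%:R * (q c * q c) = 1.
  move=> cC; rewrite r2 /p /q; have := r0 c cC; move: (r c) => a a0.
  have -> : t^-1 * t^-1 + a * a * ((t * a)^-1 * (t * a)^-1) = 2 / (t * t).
    by field; apply/andP.
  by rewrite t2 divff ?pnatr_eq0.
have eL c x : c \in C -> x \in L c -> e c x by move=> _; apply: edgeL.
have sL c c' x : c \in C -> c' \in C -> c != c' -> x \in L c ->
  [/\ x != c', x \notin L c', ~~ e c' x & forall x', x' \in L c' -> ~~ e x x'].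
  by rewrite !inE => _; apply: sepL.
have VV := star_mx_proj C L p q eL sL pR qR nm.
have := star_mx_shifted_adj C L p q eL sL pR qR nm.
set V := star_mx C L p q in VV *; set M := V *m _ *m _ => ME.
pose d c := if c \in C then 2 * r c - 1 else 0.
have MdE c c' : M c c' = if c == c' then d c else 0.
  rewrite ME mxE /d; have [<-|cc'] := eqVneq c c'; last first.
    case: ifP => //; rewrite !inE => /andP[h h'].
    by rewrite (negPf (cenL _ _ h h' cc')) mulr0 mul0r.
  rewrite andbb; case: ifP => // cC; rewrite r2 /p /q; have := r0 c cC.
  move: (r c) => a a0; congr (_ - 1).
  have -> : 4 * (a * a) * (t^-1 / (t * a)) = 4 / (t * t) * a.
    by field; apply/andP.
  by rewrite t2; field.
have c0C : c0 \in C by rewrite inE.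
(* [B] must also dominate the zero entries coming from vertices outside [C]. *)
have d0 : 0 <= d c0.
  rewrite /d c0C subr_ge0 -[leLHS]mulr1; apply: ler_pM => //; first by rewrite ler1n.
  by rewrite -[1]sqrtC1 ler_sqrtC ?qualifE //= ?ler0n ?ler1n ?card_gt0.
have dmax c : d c <= d c0.
  rewrite {1}/d; case: ifP => // cC; rewrite /d c0C lerD2r ler_wpM2l //.
  by rewrite ler_sqrtC ?qualifE //= ?ler0n // ler_nat.
have := excess_ge V (d c0) VV d0 (quad_form_diag _ _ _ MdE dmax).
apply: le_trans; rewrite -/M -addrA lerD2l /mxtrace [X in _ <= X - _](bigD1 c0) //= MdE eqxx [d c0 + _]addrC addrK.
rewrite big_mkcond [leRHS]big_mkcond; apply: ler_sum => c _.
by rewrite MdE eqxx /d inE; case: eqP => _; case: eqP => _ //=; rewrite lexx.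
Qed.

(** The 2 by 2 compression has diagonal [al] and off-diagonal [be], hence eigenvalues al + be and al
    - be. Giving up the larger leaves 1 + al - be = s - 1. *)
Lemma double_star_excess (u w : 'I_n) (Lu Lw : {set 'I_n}) (k : nat) :
  e u w -> (0 < k)%N -> #|Lu| = k -> #|Lw| = k ->
  (forall x, x \in Lu -> [/\ e u x, x != w, x \notin Lw & ~~ e w x]) ->
  (forall x, x \in Lw -> [/\ e w x, x != u, x \notin Lu & ~~ e u x]) ->
  (forall x y, x \in Lu -> y \in Lw -> ~~ e x y) ->
  sqrtC (1 + 4 * k%:R) - 1 <= excess _ e.
Proof.
move=> euw k0 Luk Lwk LuP LwP Luw.
have uw : u != w by apply/eqP => E; rewrite E e_irr in euw.
have wu : w != u by rewrite eq_sym.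
pose C := [set u; w]; pose L c := if c == u then Lu else Lw.
have LE c : #|L c| = k by rewrite /L; case: ifP.
set s := sqrtC (1 + 4 * k%:R).
have s2 : s * s = 1 + 4 * k%:R by rewrite -expr2 sqrtCK.
have k1 : (1 : algC) <= k%:R by rewrite ler1n.
have s_gt2 : 2 <= s.
  rewrite -(@ler_pXn2r _ 2) ?nnegrE //; last by rewrite sqrtC_ge0 addr_ge0 // mulr_ge0.
  rewrite expr2 [leRHS]expr2 s2 (_ : 2 * 2 = 0 + 4 * 1); last by ring.
  by rewrite lerD // ler_wpM2l.
have s0 : 0 < s by apply: lt_le_trans s_gt2.
have s1 : 0 < s - 1.
  by rewrite subr_gt0; apply: lt_le_trans s_gt2; rewrite ltr1n.
have sN0 : s != 0 by rewrite gt_eqF.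
have s1N0 : s - 1 != 0 by rewrite gt_eqF.
(* These centre and leaf weights [a], [b] maximise [4 k a b - 2 a^2] on
   [a^2 + k b^2 = 1]: they are the optimal test vector for the second eigenvalue. *)
pose a : algC := sqrtC ((s - 1) / (2 * s)).
have a2 : a * a = (s - 1) / (2 * s) by rewrite -expr2 sqrtCK.
have a0 : 0 < a by rewrite sqrtC_gt0 divr_gt0 // mulr_gt0.
have aN0 : a != 0 by rewrite gt_eqF.
pose b := (s * a)^-1.
have ab : a * b = s^-1 by rewrite /b; field; apply/andP.
have kE : k%:R = (s * s - 1) / 4 by rewrite s2; field.
have aR : a^* = a by apply/CrealP; rewrite gtr0_real.
have bR : b^* = b by apply/CrealP; rewrite realV realM ?gtr0_real.
have nm : a * a + k%:R * (b * b) = 1.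
  have -> : b * b = (s * s * (a * a))^-1 by rewrite /b; field; apply/andP.
  by rewrite a2 kE; field; rewrite sN0 s1N0.
have eL c x : c \in C -> x \in L c -> e c x.
  rewrite !inE /L => /orP[]/eqP->; first by rewrite eqxx => /LuP[].
  by rewrite (negPf wu) => /LwP[].
have sL c c' x : c \in C -> c' \in C -> c != c' -> x \in L c ->
  [/\ x != c', x \notin L c', ~~ e c' x & forall x', x' \in L c' -> ~~ e x x'].
  rewrite !inE /L => /orP[]/eqP-> /orP[]/eqP->; rewrite ?eqxx // => _.
  - rewrite (negPf wu) => xL; have [_ ? ? ?] := LuP _ xL; split => //.
    by move=> y yL; apply: Luw.
  - rewrite (negPf wu) => xL; have [_ ? ? ?] := LwP _ xL; split => //.
    by move=> y yL; rewrite e_sym; apply: Luw.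
have nmL c : c \in C -> a * a + #|L c|%:R * (b * b) = 1 by rewrite LE.
pose pa (c : 'I_n) := a; pose pb (c : 'I_n) := b.
have VV := star_mx_proj C L pa pb eL sL (fun=> aR) (fun=> bR) nmL.
have := star_mx_shifted_adj C L pa pb eL sL (fun=> aR) (fun=> bR) nmL.
set V := star_mx C L pa pb in VV *; set M := V *m _ *m _ => ME.
pose al := s - 1 - s^-1; pose be := 1 - s^-1.
have alE : 4 * k%:R * (a * b) - 1 = al by rewrite ab kE /al; field.
have beE : 2 * (a * a) = be by rewrite a2 /be; field.
have is1 : s^-1 <= 1 by rewrite invf_le1 // -subr_ge0 ltW.
have be0 : 0 <= be by rewrite subr_ge0.
have al0 : 0 <= al.
  rewrite subr_ge0; apply: le_trans is1 _.
  by rewrite lerBrDr -[1 + 1]/(2%:R).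
have Muu : M u u = al by rewrite ME mxE !inE !eqxx /= LE.
have Mww : M w w = al by rewrite ME mxE !inE !eqxx orbT /= LE.
have Muw : M u w = be by rewrite ME mxE !inE !eqxx orbT /= (negPf uw) euw mulr1.
have Mwu : M w u = be.
  by rewrite ME mxE !inE !eqxx orbT /= (negPf wu) e_sym euw mulr1.
have M0 c c' : ~~ ((c \in C) && (c' \in C)) -> M c c' = 0.
  by rewrite ME mxE => /negPf->.
have sumC (F : 'I_n -> algC) : (forall c, c \notin C -> F c = 0) ->
    \sum_c F c = F u + F w.
  move=> F0; rewrite (bigD1 u) //= (bigD1 w) 1?eq_sym //= big1 ?addr0 // => c.
  by move=> /andP[cu cw]; apply: F0; rewrite !inE negb_or cu.
have quad (v : 'rV_n) : (v *m M *m v ^t*) 0 0 <= (al + be) * (v *m v ^t*) 0 0.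
  have vT c : (v ^t*) c 0 = (v 0 c)^* by rewrite !mxE.
  have vM c : (v *m M) 0 c = v 0 u * M u c + v 0 w * M w c.
    by rewrite mxE sumC // => i iC; rewrite M0 ?mulr0 // (negPf iC).
  have -> : (v *m M *m v ^t*) 0 0 =
      al * (`|v 0 u| ^+ 2 + `|v 0 w| ^+ 2) +
      be * (v 0 u * (v 0 w)^* + v 0 w * (v 0 u)^*).
    rewrite mxE sumC => [|c cC].
      by rewrite !vM !vT Muu Mww Muw Mwu !normCK; ring.
    by rewrite vM !M0 ?(negPf cC) ?andbF // !mulr0 addr0 mul0r.
  have vv : `|v 0 u| ^+ 2 + `|v 0 w| ^+ 2 <= (v *m v ^t*) 0 0.
    rewrite mxE (bigD1 u) //= (bigD1 w) 1?eq_sym //= !mxE -!normCK addrA lerDl.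
    by rewrite sumr_ge0 // => c _; rewrite !mxE -normCK exprn_ge0.
  apply: le_trans (_ : (al + be) * (`|v 0 u| ^+ 2 + `|v 0 w| ^+ 2) <= _); last first.
    by rewrite ler_wpM2l // addr_ge0.
  rewrite [leRHS]mulrDl lerD2l ler_wpM2l // -subr_ge0.
  rewrite [leRHS](_ : _ = `|v 0 u - v 0 w| ^+ 2) ?exprn_ge0 //.
  by rewrite !normCK rmorphB /=; ring.
have := excess_ge V (al + be) VV (addr_ge0 al0 be0) quad.
apply: le_trans; rewrite -/M /mxtrace sumC ?Muu ?Mww => [|c cC].
  by rewrite le_eqVlt; apply/orP; left; apply/eqP; rewrite /al /be; ring.
by rewrite M0 // (negPf cC).
Qed.

End Stars.

(** * Rooted trees *)

(** A new index with r = sqrt l raises (1 + x)^2 by 4 r^2 - 1 + 2 x (2 r - 1), which is at least 4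
    r^2 once x >= 1. *)
Lemma sum_sqrt_bounds (T : finType) (P : pred T) (l : T -> nat) :
  (forall i, P i -> (0 < l i)%N) ->
  let X : algC := 1 + \sum_(i | P i) (2 * sqrtC (l i)%:R - 1) in
  4 * (\sum_(i | P i) l i)%N%:R <= X ^+ 2 /\ 1 + #|P|%:R <= X.
Proof.
have -> : #|P|%:R = \sum_(i | P i) 1 :> algC by rewrite -sum1_card natr_sum.
move=> l0 X.
(* The empty sum is kept apart: there x = 0, and the slack 1 in (1 + x)^2 pays for the first
   step. *)
pose I (a : nat) (x y : algC) :=
  (a = 0 /\ x = 0 /\ y = 0) \/ [/\ 1 <= x, 4 * a%:R <= (1 + x) ^+ 2 & y <= x].
suff: I (\sum_(i | P i) l i)%N (\sum_(i | P i) (2 * sqrtC (l i)%:R - 1)) (\sum_(i | P i) 1).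
  rewrite /X; case=> [[-> [-> ->]]|[h1 h2 h3]]; last by rewrite lerD2l.
  by rewrite mulr0 addr0 expr1n ler01 lexx.
have step (r : algC) a x y : 1 <= r -> I a x y ->
    [/\ 1 <= 2 * r - 1 + x, 4 * (r ^+ 2 + a%:R) <= (1 + (2 * r - 1 + x)) ^+ 2 &
       1 + y <= 2 * r - 1 + x].
  move=> r1; have r0 : 0 <= r by apply: le_trans r1.
  have r21 : 1 <= 2 * r - 1 by rewrite lerBrDr -[1 + 1]/(2%:R) ler_peMr.
  case=> [[-> [-> ->]]|[h1 h2 h3]].
    rewrite !addr0 r21; split=> //.
    by rewrite le_eqVlt; apply/orP; left; apply/eqP; ring.
  split; last by rewrite lerD.
    by rewrite -[leLHS]addr0 lerD // (le_trans _ h1).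
  rewrite -subr_ge0 [leRHS](_ : _ = ((1 + x) ^+ 2 - 4 * a%:R) +
     (1 + 4 * (r - 1) + 2 * (x - 1) + 4 * ((x - 1) * (r - 1)))); last by ring.
  rewrite -subr_ge0 in r1; rewrite -subr_ge0 in h1; rewrite -subr_ge0 in h2.
  move: r1 h1 h2; set r' := r - 1; set x' := x - 1; set d := _ ^+ 2 - _ => r1 h1 h2.
  apply: addr_ge0 => //; apply: addr_ge0; last by rewrite !mulr_ge0.
  by apply: addr_ge0; rewrite ?mulr_ge0 // addr_ge0 // mulr_ge0.
elim/big_rec3: _ => [|i y x a Pi IH]; first by left.
have h : (1 : algC) <= sqrtC (l i)%:R.
  by rewrite -[leLHS]sqrtC1 ler_sqrtC ?qualifE //= ?ler0n ?ler1n ?l0 //.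
by right; have [] := step _ _ _ _ h IH; rewrite sqrtCK natrD.
Qed.

(** * Depth classes of a rooted tree as star forests *)

Section RootedTree.
Variables (n : nat) (e : rel 'I_n) (w : 'I_n) (par : 'I_n -> 'I_n) (dep : 'I_n -> nat).
Hypothesis n_gt0 : (0 < n)%N.
Hypothesis eE : forall x y,
  e x y = (x != w) && (par x == y) || (y != w) && (par y == x).
Hypothesis depS : forall x, x != w -> dep x = (dep (par x)).+1.
Hypothesis dep0 : dep w = 0%N.

Let f := excess _ e.

Lemma rooted_sym : symmetric e.
Proof. by move=> x y; rewrite !eE orbC. Qed.

Lemma rooted_irr : irreflexive e.
Proof.
move=> x; rewrite eE orbb; apply/andP => -[/depS + /eqP pe].
by rewrite pe => /eqP; rewrite ltn_eqF.
Qed.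

Lemma rooted_colour x y : e x y -> odd (dep x) != odd (dep y).
Proof.
by rewrite eE => /orP[] /andP[/depS-> /eqP->] /=; case: (odd _).
Qed.

Lemma excess_real : f \is Num.real.
Proof.
rewrite /f /excess realD ?realn // realB ?realn // realM ?realV ?realn //.
by rewrite ger0_real // sumr_ge0.
Qed.

Lemma excess_ge1 : 1 <= f.
Proof.
have := excess_ge _ e (odd \o dep) n_gt0 rooted_irr rooted_sym rooted_colour 0 0.
rewrite !mul0mx linear0 addr0 subr0; apply=> // c.
by rewrite mulmx0 mul0mx mul0r mxE.
Qed.

Definition kids (K : {set 'I_n}) c := [set x in K | par x == c].

(* [K] is the set of leaves of a family of stars centred at [par @: K]; these
   conditions say that the family is an induced subgraph. *)
Definition star_leaves (K : {set 'I_n}) : Prop :=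
  [/\ w \notin K, forall x, x \in K -> par x \notin K,
      forall x, x \in K -> par x != w -> par (par x) \notin K &
      forall x y, x \in K -> y \in K -> par x != w -> par (par x) != par y].

(** The stars are the sets [kids K c] around their centres. The leading 1 in [sum_sqrt_bounds]
    accounts for the centre [c0] of the star given up. *)
Lemma star_leaves_bounds K c0 : star_leaves K ->
  (forall c, (#|kids K c| <= #|kids K c0|)%N) ->
  4 * (#|K| - #|kids K c0|)%N%:R <= f ^+ 2 /\ #|par @: K|%:R <= f.
Proof.
move=> [wK K1 K2 K3] Kmax.
have [K0|[x0 x0K]] := set_0Vmem K.
  rewrite K0 imset0 !cards0 sub0n mulr0 real_exprn_even_ge0 ?excess_real //.
  by split=> //; apply: le_trans excess_ge1.
have inw x : x \in K -> x != w by apply: contraTneq => ->.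
have kidsP c : reflect (exists2 x, x \in K & par x = c) (kids K c != set0).
  apply: (iffP (set0Pn _)) => [[x]|[x xK <-]].
    by rewrite inE => /andP[? /eqP]; exists x.
  by exists x; rewrite inE xK /=.
have c0N : kids K c0 != set0.
  rewrite -card_gt0; apply: leq_trans (Kmax (par x0)); rewrite card_gt0.
  by apply/kidsP; exists x0.
have H1 c x : x \in kids K c -> e c x.
  by rewrite inE => /andP[xK /eqP<-]; rewrite eE (inw _ xK) eqxx orbT.
have H2 c c' : kids K c != set0 -> kids K c' != set0 -> c != c' -> ~~ e c c'.
  move=> /kidsP[x xK xc] /kidsP[y yK yc] cc'; rewrite eE.
  apply/negP => /orP[] /andP[cw /eqP E].
    by have := K3 x y xK yK; rewrite xc yc E eqxx => /(_ cw).
  by have := K3 y x yK xK; rewrite xc yc E eqxx => /(_ cw).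
have H3 c c' x : kids K c' != set0 -> c != c' -> x \in kids K c ->
     [/\ x != c', x \notin kids K c', ~~ e c' x &
      forall x', x' \in kids K c' -> ~~ e x x'].
  move=> /kidsP[y yK yc] cc'; rewrite inE => /andP[xK /eqP xc]; split.
  - by apply: contraNneq (K1 y yK) => E; rewrite yc -E.
  - by rewrite inE xc (negPf cc') andbF.
  - rewrite eE xc (negPf cc') andbF orbF.
    apply/negP => /andP[cw /eqP E]; have := K2 y yK.
    by rewrite yc E xK => /(_ cw).
  - move=> z; rewrite inE => /andP[zK /eqP zc]; rewrite eE.
    apply/negP => /orP[] /andP[_ /eqP E].
      by have := K1 x xK; rewrite E zK.
    by have := K1 z zK; rewrite E xK.
have h := star_forest_excess _ e (odd \o dep) n_gt0 rooted_irr rooted_sym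
  rooted_colour _ c0 H1 H2 H3 c0N Kmax.
have P0 c : (kids K c != set0) && (c != c0) -> (0 < #|kids K c|)%N.
  by rewrite card_gt0 => /andP[].
have [h1 h2] := sum_sqrt_bounds _ _ _ P0.
set X := 1 + \sum_(_ | _) _ in h h1 h2.
have Kc : #|K| = (\sum_c #|kids K c|)%N.
  rewrite -sum1_card (partition_big par xpredT) //=; apply: eq_bigr => c _.
  by rewrite -sum1_card; apply: eq_bigl => x; rewrite inE.
have sumE : (#|K| - #|kids K c0|)%N =
    (\sum_(c | (kids K c != set0) && (c != c0)) #|kids K c|)%N.
  rewrite Kc (bigD1 c0) //= addKn big_mkcond [RHS]big_mkcond /=.
  apply: eq_bigr => c _; case: eqP => _; rewrite ?andbF ?andbT //.
  by case: eqP => // ->; rewrite cards0.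
have cE : #|par @: K| = #|[pred c | (kids K c != set0) && (c != c0)]|.+1.
  rewrite (cardD1 c0) (_ : (c0 \in par @: K) = true); last first.
    by have /kidsP[x xK <-] := c0N; apply: imset_f.
  rewrite add1n; congr _.+1; apply: eq_card => c; rewrite !inE andbC; congr (_ && _).
  by apply/imsetP/kidsP => -[x xK E]; exists x.
have X0 : 0 <= X by apply: le_trans h2; rewrite addr_ge0.
split; last by rewrite cE -add1n natrD; apply: le_trans h2 h.
rewrite sumE; apply: le_trans h1 _; rewrite ler_pXn2r // nnegrE //.
exact: le_trans h.
Qed.

Definition children := kids [set~ w].

Definition depth_class i := [set x | (x != w) && (dep x %% 3 == i)%N].

Lemma in_children x c : (x \in children c) = (x != w) && (par x == c).
Proof. by rewrite !inE. Qed.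

Lemma degree_root : degree e w = #|children w|.
Proof. by apply: eq_card => x; rewrite in_children inE eE eqxx. Qed.

Lemma degree_nonroot c : c != w -> degree e c = #|children c|.+1.
Proof.
move=> cw; have pc : par c \notin children c.
  rewrite in_children; apply/negP => /andP[/depS h /eqP E].
  by have := depS c cw; rewrite h E; clear; lia.
have <- : #|par c |: children c| = #|children c|.+1 by rewrite cardsU1 pc.
by apply: eq_card => x; rewrite in_setU1 in_children inE eE cw eq_sym.
Qed.

(** Leaves, centres and parents of centres have depths i, i - 1 and i - 2, which are distinct modulo
    3. *)
Lemma star_leaves_depth i : star_leaves (depth_class i).
Proof.
split=> [|x|x|x y]; rewrite !inE ?eqxx // => /andP[xw /eqP].
- have := depS x xw; case: (par x != w) => //= h1 h2; lia.
- move=> h2 pw; have := depS x xw; have := depS _ pw; rewrite negb_and; lia.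
- move=> h2 /andP[yw /eqP h3] pw; apply/negP => /eqP E.
  by have := depS x xw; have := depS _ pw; have := depS y yw; rewrite E; lia.
Qed.

Lemma kids_depth_sub i c : kids (depth_class i) c \subset children c.
Proof.
by apply/subsetP => x; rewrite in_children !inE => /andP[/andP[-> _] ->].
Qed.

Lemma rooted_order :
  n = (#|depth_class 0| + #|depth_class 1| + #|depth_class 2|).+1.
Proof.
have h : setT = w |: (depth_class 0 :|: depth_class 1 :|: depth_class 2).
  apply/setP => x; rewrite !inE; case: (x == w) => //=.
  by have := ltn_pmod (dep x) (isT : (0 < 3)%N); case: (_ %% _)%N => [|[|[|]]].
have d1 : [disjoint depth_class 0 & depth_class 1].
  by rewrite disjoint_subset; apply/subsetP => x; rewrite !inE; clear; lia.
have d2 : [disjoint depth_class 0 :|: depth_class 1 & depth_class 2].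
  by rewrite disjoint_subset; apply/subsetP => x; rewrite !inE; clear; lia.
have w0 : w \notin depth_class 0 :|: depth_class 1 :|: depth_class 2.
  by rewrite !inE eqxx.
rewrite -[LHS]card_ord -cardsT h cardsU1 w0 add1n.
by rewrite cardsU (disjoint_setI0 d2) cardsU (disjoint_setI0 d1) !cards0 !subn0.
Qed.

Section MaxDegreeRoot.
Hypothesis root_max : forall c, c != w -> (#|children c| < #|children w|)%N.

Lemma children_root_max c : (#|children c| <= #|children w|)%N.
Proof. by have [->//|/root_max/ltnW] := eqVneq c w. Qed.

Lemma dep_child x : x \in children w -> dep x = 1%N.
Proof. by rewrite in_children => /andP[/depS-> /eqP->]; rewrite dep0. Qed.

(** The star given up is that of the root, which is largest by [root_max] and lies wholly in this
    class. *)
Lemma depth1_bound : 4 * (#|depth_class 1| - #|children w|)%N%:R <= f ^+ 2.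
Proof.
have kw : kids (depth_class 1) w = children w.
  apply/eqP; rewrite eqEsubset kids_depth_sub; apply/subsetP => x xw.
  move: (xw); rewrite in_children => /andP[x1 x2].
  by rewrite !inE x1 x2 dep_child.
have [c|+ _] := star_leaves_bounds (depth_class 1) w (star_leaves_depth 1).
  rewrite kw; apply: leq_trans (children_root_max c).
  exact: subset_leq_card (kids_depth_sub _ _).
by rewrite kw.
Qed.

(** The star of [c] is paired with that of the root. Dropping [par c] from the latter removes the
    only possible adjacency; strictness in [root_max] keeps the root star at least as large, so it
    is the one given up. *)
Lemma deep_children_bound c : c != w -> par c != w ->
  4 * #|children c|%:R <= f ^+ 2.
Proof.
move=> cw pcw; have dc := depS c cw; have dpc := depS _ pcw.
pose K := (children w :\ par c) :|: children c.
have KP x : x \in K -> x != w /\ (par x = w /\ x != par c \/ par x = c).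
  by rewrite in_setU in_setD1 !in_children => /orP[/and3P[? ? /eqP]|/andP[? /eqP]]; auto.
have KN x : x != w -> ~ (par x = w /\ x != par c \/ par x = c) -> x \notin K.
  by move=> _ h; apply/negP => /KP[_ /h].
have Kv : star_leaves K.
  split=> [|x /KP[xw xP]|x /KP[xw xP] pw|x y /KP[xw xP] /KP[yw yP] pw].
  - by apply/negP => /KP[]; rewrite eqxx.
  - have [pxw|pxw] := eqVneq (par x) w; first by rewrite pxw; apply/negP => /KP[]; rewrite eqxx.
    case: xP => [[/eqP]|xc]; first by rewrite (negPf pxw).
    rewrite xc; apply: KN => // -[[/eqP]|E]; first by rewrite (negPf pcw).
    by move: dc; rewrite E; lia.
  - case: xP => [[/eqP]|xc]; first by rewrite (negPf pw).
    rewrite xc; apply: KN => // -[[_]|E]; first by rewrite eqxx.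
    by move: dc dpc; rewrite E; lia.
  - case: xP => [[/eqP]|xc]; first by rewrite (negPf pw).
    rewrite xc; case: yP => [[-> _]|->] //.
    by apply/eqP => E; move: dc; rewrite E; lia.
have kw : kids K w = children w :\ par c.
  apply/setP => x; rewrite in_set in_setU in_setD1 !in_children.
  case: (x != w); rewrite ?andbF //=.
  have [->|_] := eqVneq (par x) w; rewrite ?andbF //=.
  by rewrite [w == c]eq_sym (negPf cw) orbF andbT.
have kc : kids K c = children c.
  apply/setP => x; rewrite in_set in_setU in_setD1 !in_children.
  case: (x != w); rewrite ?andbF //=; by case: (par x == c); rewrite ?andbF ?orbT.
have ko x : x != w -> x != c -> kids K x = set0.
  move=> xw xc; apply/setP => y; rewrite in_set in_set0.
  apply/negP => /andP[/KP[_ []] h /eqP E].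
    by case: h => h _; rewrite -E h eqxx in xw.
  by rewrite -E h eqxx in xc.
have wc : (#|children c| <= #|children w :\ par c|)%N.
  rewrite -ltnS; apply: leq_trans (root_max c cw) _.
  by rewrite (cardsD1 (par c)) -add1n leq_add2r leq_b1.
have [d|+ _] := star_leaves_bounds K w Kv.
  have [->//|dw] := eqVneq d w; have [->|dc'] := eqVneq d c; first by rewrite kw kc.
  by rewrite ko // cards0.
rewrite kw cardsU (_ : _ :&: _ = set0) ?cards0 ?subn0 ?addKn //.
apply/setP => x; rewrite in_setI in_setD1 !in_children in_set0.
apply/negP => /andP[/and3P[_ _ /eqP->]] /andP[_ /eqP E].
by rewrite E eqxx in cw.
Qed.

(** Here [c] is adjacent to the root, so the two stars, the root one trimmed to k leaves, form a
    double star. Squaring sqrt (1 + 4 k) <= f + 1 gives the claim. *)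
Lemma shallow_children_bound c : c != w -> par c = w -> (0 < #|children c|)%N ->
  4 * #|children c|%:R <= f ^+ 2 + 2 * f.
Proof.
move=> cw pc k0; set k := #|children c| in k0 *.
have wk : (k <= #|children w :\ c|)%N.
  rewrite -ltnS; apply: leq_trans (root_max c cw) _.
  by rewrite (cardsD1 c) -add1n leq_add2r leq_b1.
have /set0Pn[Lw] : [set A : {set 'I_n} | (A \subset children w :\ c) & (#|A| == k)] != set0.
  by rewrite -card_gt0 cards_draws bin_gt0.
rewrite inE => /andP[/subsetP Lsub /eqP Lk].
have LP x : x \in Lw -> [/\ x != w, x != c & par x = w].
  by move=> /Lsub; rewrite in_setD1 in_children => /and3P[? ? /eqP].
have CP x : x \in children c -> x != w /\ par x = c.
  by rewrite in_children => /andP[? /eqP].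
have wc : w != c by rewrite eq_sym.
have h := double_star_excess _ e (odd \o dep) n_gt0 rooted_irr rooted_sym
  rooted_colour w c Lw (children c) k.
have : sqrtC (1 + 4 * k%:R) - 1 <= f.
  apply: h => //.
  - by rewrite eE cw pc eqxx orbT.
  - move=> x xL; have [xw xc pxw] := LP x xL; split=> //.
    + by rewrite eE xw pxw eqxx orbT.
    + by rewrite in_children pxw xw (negPf wc).
    + by rewrite eE cw pc xw pxw (negPf wc) orbF eq_sym.
  - move=> x /CP[xw pxc]; split=> //.
    + by rewrite eE xw pxc eqxx orbT.
    + by apply/negP => /LP[_ _ /eqP]; rewrite pxc (negPf cw).
    + by rewrite eE eqxx xw pxc (negPf cw).
  - move=> x y xL /CP[yw pyc]; have [xw xc pxw] := LP x xL.
    rewrite eE xw yw pxw pyc /= negb_or eq_sym yw /=.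
    by rewrite eq_sym.
rewrite lerBlDr => h1.
have : sqrtC (1 + 4 * k%:R) ^+ 2 <= (f + 1) ^+ 2.
  have f0 : 0 <= f + 1 := addr_ge0 (le_trans ler01 excess_ge1) ler01.
  by rewrite ler_pXn2r ?nnegrE ?f0 // sqrtC_ge0 addr_ge0 ?mulr_ge0.
rewrite sqrtCK => h2; rewrite -(lerD2l 1).
by rewrite [leRHS](_ : _ = (f + 1) ^+ 2) //; ring.
Qed.

Lemma children_bound c : c != w -> 4 * #|children c|%:R <= f ^+ 2 + 2 * f.
Proof.
move=> cw; have f0 : 0 <= f by apply: le_trans excess_ge1.
have f20 : 0 <= f ^+ 2 + 2 * f by rewrite addr_ge0 ?exprn_ge0 // mulr_ge0.
have [pc|pc] := eqVneq (par c) w; last first.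
  by apply: le_trans (deep_children_bound _ cw pc) _; rewrite lerDl mulr_ge0.
have [->|k0] := posnP #|children c|; first by rewrite mulr0.
exact: shallow_children_bound.
Qed.

(** [t] is the size of a largest star and [u] the rest. Its centre has depth 1 modulo 3, so it is
    not the root but may be a child of the root; hence the extra 2 f. *)
Lemma depth2_bound : exists u t : nat, [/\ (#|depth_class 2| <= u + t)%N,
  4 * u%:R <= f ^+ 2 & 4 * t%:R <= f ^+ 2 + 2 * f].
Proof.
have [c _ cmax] := @arg_maxnP _ w xpredT (fun c => #|kids (depth_class 2) c|) isT.
have [h _] := star_leaves_bounds _ c (star_leaves_depth 2) (fun d => cmax d isT).
exists (#|depth_class 2| - #|kids (depth_class 2) c|)%N, #|kids (depth_class 2) c|.
split=> //; first by rewrite addnC -leq_subLR.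
have [->|[x]] := set_0Vmem (kids (depth_class 2) c).
  have f0 : 0 <= f by apply: le_trans excess_ge1.
  by rewrite cards0 mulr0 addr_ge0 ?exprn_ge0 // mulr_ge0.
rewrite !inE => /andP[/andP[xw /eqP x2]] /eqP xc.
have cw : c != w.
  by apply/eqP => E; move: x2; rewrite depS // xc E dep0.
apply: le_trans (children_bound c cw); rewrite ler_wpM2l // ler_nat.
exact: subset_leq_card (kids_depth_sub _ _).
Qed.

(** Centres now have depth 2 modulo 3, so neither they nor their parents are the root and the
    sharper bound holds for [s]. The last clause serves small [f], where [s] is at most 1. *)
Lemma depth0_bound : exists u s : nat, [/\ (#|depth_class 0| <= u + s)%N,
  4 * u%:R <= f ^+ 2, 4 * s%:R <= f ^+ 2 &
  (#|depth_class 0| <= #|par @: depth_class 0| * s)%N].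
Proof.
have [c _ cmax] := @arg_maxnP _ w xpredT (fun c => #|kids (depth_class 0) c|) isT.
have [h _] := star_leaves_bounds _ c (star_leaves_depth 0) (fun d => cmax d isT).
exists (#|depth_class 0| - #|kids (depth_class 0) c|)%N, #|kids (depth_class 0) c|.
split=> //; first by rewrite addnC -leq_subLR.
  have [->|[x]] := set_0Vmem (kids (depth_class 0) c).
    have f0 : 0 <= f by apply: le_trans excess_ge1.
    by rewrite cards0 mulr0 ?exprn_ge0.
  rewrite !inE => /andP[/andP[xw /eqP x2]] /eqP xc.
  have cw : c != w.
    by apply/eqP => E; move: x2; rewrite depS // xc E dep0.
  have pcw : par c != w.
    by apply/eqP => E; move: x2; rewrite depS // xc depS // E dep0.
  apply: le_trans (deep_children_bound c cw pcw); rewrite ler_wpM2l // ler_nat.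
  exact: subset_leq_card (kids_depth_sub _ _).
rewrite -sum1_card (partition_big par (mem (par @: depth_class 0))) /=; last first.
  by move=> x xK; apply: imset_f.
rewrite -sum_nat_const; apply: leq_sum => d _.
apply: leq_trans (cmax d isT); rewrite -sum1_card.
rewrite leq_eqVlt; apply/orP; left; apply/eqP.
by apply: eq_bigl => x; rewrite [RHS]inE.
Qed.

Definition leaf_children := [set x in children w | children x == set0].

(** A child of the root with children of its own is a centre in [depth_class 2], so the bound on
    centres applies. *)
Lemma branch_children_bound :
  #|children w :\: leaf_children|%:R <= f /\
  (#|children w :\: leaf_children| <= #|depth_class 2|)%N.
Proof.
have [c _ cmax] := @arg_maxnP _ w xpredT (fun c => #|kids (depth_class 2) c|) isT.
have [_ h] := star_leaves_bounds _ c (star_leaves_depth 2) (fun d => cmax d isT).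
have sub : children w :\: leaf_children \subset par @: depth_class 2.
  apply/subsetP => x; rewrite in_setD in_set => /andP[+ xw]; rewrite xw /=.
  move/set0Pn => [y]; rewrite in_children => /andP[yw /eqP yx].
  apply/imsetP; exists y => //.
  by rewrite inE yw depS // yx dep_child.
split; first by apply: le_trans h; rewrite ler_nat subset_leq_card.
exact: leq_trans (subset_leq_card sub) (leq_imset_card _ _).
Qed.

(** The leaf children of the root can join [depth_class 0] without breaking the induced star forest;
    if there are any, the root becomes one more centre. *)
Lemma depth0_centres_bound :
  (#|par @: depth_class 0| + (0 < #|leaf_children|))%N%:R <= f.
Proof.
pose K := depth_class 0 :|: leaf_children.
have KP x : x \in K -> x != w /\ ((dep x %% 3 = 0)%N \/ par x = w /\ children x = set0).
  by rewrite in_setU in_set in_set in_children =>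
    /orP[/andP[? /eqP]|/andP[/andP[? /eqP ?] /eqP ?]]; auto.
have nochild x : x != w -> children (par x) <> set0.
  by move=> xw /setP/(_ x); rewrite in_children xw eqxx in_set0.
have Kv : star_leaves K.
  split=> [|x /KP[xw xP]|x /KP[xw xP] pw|x y /KP[xw xP] /KP[yw yP] pw].
  - by apply/negP => /KP[]; rewrite eqxx.
  - apply/negP => /KP[pw [h|[_ /(nochild _ xw)]]] //.
    case: xP => [h2|[/eqP]]; last by rewrite (negPf pw).
    by have := depS _ xw; lia.
  - apply/negP => /KP[ppw [h|[_ /(nochild _ pw)]]] //.
    case: xP => [h2|[/eqP]]; last by rewrite (negPf pw).
    by have := depS _ xw; have := depS _ pw; lia.
  - case: xP => [h2|[/eqP]]; last by rewrite (negPf pw).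
    have h3 := depS _ xw; have h4 := depS _ pw.
    apply/eqP => E; rewrite E in h4.
    case: yP => [h5|[h5 _]]; first by have := depS _ yw; lia.
    by rewrite h5 dep0 in h4; lia.
have [c _ cmax] := @arg_maxnP _ w xpredT (fun c => #|kids K c|) isT.
have [_ h] := star_leaves_bounds _ c Kv (fun d => cmax d isT).
apply: le_trans h; rewrite ler_nat.
have wN : w \notin par @: depth_class 0.
  apply/imsetP => -[x]; rewrite inE => /andP[xw /eqP x0] E.
  by have := depS _ xw; rewrite -E dep0; lia.
have s0 : par @: depth_class 0 \subset par @: K by apply/imsetS/subsetUl.
have [_|/card_gt0P[y yL]] := posnP #|leaf_children|; first by rewrite addn0 subset_leq_card.
rewrite addn1 -add1n.
rewrite (_ : (1 + _)%N = #|w |: par @: depth_class 0|); last by rewrite cardsU1 wN.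
rewrite subset_leq_card // subUset sub1set s0 andbT; apply/imsetP; exists y.
  by rewrite in_setU yL orbT.
by move: yL; rewrite in_set in_children => /andP[/andP[_ /eqP]].
Qed.

End MaxDegreeRoot.
End RootedTree.

(** * Rooting a connected acyclic graph by distance *)

Section RootTree.
Variables (n : nat) (e : rel 'I_n) (w : 'I_n).
Hypothesis e_irr : irreflexive e.
Hypothesis e_sym : symmetric e.
Hypothesis e_conn : forall x y, connect e x y.
Hypothesis e_acyc : forall c : seq 'I_n, (3 <= size c)%N -> ~~ ucycleb e c.

(** Quantifying over tuples of fixed length makes this boolean, as [ex_minn] requires. *)
Let reach x k := [exists p : k.-tuple 'I_n, path e w p && (last w p == x)].

Let reach_ex x : exists k, reach x k.
Proof.
have /connectP[p pw ->] := e_conn w x.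
by exists (size p); apply/existsP; exists (in_tuple p); rewrite pw eqxx.
Qed.

Definition root_dist x := ex_minn (reach_ex x).

Let dist_le x p : path e w p -> last w p = x -> (root_dist x <= size p)%N.
Proof.
move=> pw lx; rewrite /root_dist; case: ex_minnP => k _; apply.
by apply/existsP; exists (in_tuple p); rewrite pw lx eqxx.
Qed.

Let dist_path x : exists p, [/\ path e w p, last w p = x & size p = root_dist x].
Proof.
rewrite /root_dist; case: ex_minnP => k /existsP[p /andP[pw /eqP lx]] _.
by exists p; rewrite size_tuple.
Qed.

Let dist_root : root_dist w = 0%N.
Proof. by apply/eqP; rewrite -leqn0; apply: (dist_le w [::]). Qed.

Let dist_edge x y : e x y -> (root_dist y <= (root_dist x).+1)%N.
Proof.
move=> exy; have [p [pw lx <-]] := dist_path x.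
by rewrite -(size_rcons p y); apply: dist_le; rewrite ?rcons_path ?last_rcons ?pw ?lx.
Qed.

Let dist_pred x : x != w -> exists y, e x y && (root_dist x == (root_dist y).+1).
Proof.
move=> xw; have [p [pw lx sx]] := dist_path x.
case/lastP: p pw lx sx => [_ /= wx|p y]; first by rewrite wx eqxx in xw.
rewrite rcons_path last_rcons size_rcons => /andP[pw ly] yx sx.
have dle := dist_le _ p pw erefl; have := dist_edge _ _ ly.
rewrite yx in ly *; exists (last w p); rewrite e_sym ly /=; lia.
Qed.

(** At the root no vertex qualifies and the default returns [w]. *)
Definition root_parent x :=
  odflt x [pick y | e x y && (root_dist x == (root_dist y).+1)].

Let parentP x : x != w -> e x (root_parent x) /\ root_dist x = (root_dist (root_parent x)).+1.
Proof.
move=> /dist_pred[y0 h0]; rewrite /root_parent.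
by case: pickP => [y /andP[h /eqP]|/(_ y0)] //=; rewrite h0.
Qed.

Let avoid v : rel 'I_n := fun a b => [&& e a b, a != v & b != v].

(** Passing to parents strictly lowers the distance, so the chain from [x] to the root never meets
    [v]. *)
Let connect_avoid v x : w != v -> x != v -> (root_dist x <= root_dist v)%N ->
  connect (avoid v) w x.
Proof.
move=> wv; have [k] := ubnP (root_dist x).
elim: k x => // k IH x; rewrite ltnS => xk xv xlev.
have [->|xw] := eqVneq x w; first exact: connect0.
have [ex dx] := parentP x xw.
have pv : root_parent x != v.
  by apply: contraTneq xlev => pe; rewrite dx pe ltnn.
have /IH h : (root_dist (root_parent x) < k)%N by rewrite -dx.
apply: connect_trans (h pv _) _; first by rewrite ltnW // -dx.
by apply: connect1; rewrite /avoid e_sym ex pv.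
Qed.

Let path_avoid v x p : x != v -> path (avoid v) x p -> path e x p && (v \notin x :: p).
Proof.
elim: p x => [|y p IH] x xv /=; first by rewrite inE eq_sym xv.
move=> /andP[/and3P[exy _ yv]] /(IH y yv)/andP[-> h].
by rewrite exy in_cons eq_sym (negPf xv).
Qed.

(** Both neighbours reach the root without passing [v]. A duplicate-free path between them would
    close up through [v] to a cycle of length at least 3. *)
Let lower_unique v x y : v != w -> e v x -> e v y ->
  (root_dist x <= root_dist v)%N -> (root_dist y <= root_dist v)%N -> x = y.
Proof.
move=> vw evx evy dx dy; apply/eqP/negPn/negP => xy.
have nev a : e v a -> a != v by move=> h; apply: contraTneq h => ->; rewrite e_irr.
have wv : w != v by rewrite eq_sym.
have cx := connect_avoid v x wv (nev _ evx) dx.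
have cy := connect_avoid v y wv (nev _ evy) dy.
have av_sym : symmetric (avoid v).
  by move=> a b; rewrite /avoid e_sym [(a != v) && _]andbC.
have cxy : connect (avoid v) x y.
  by apply: connect_trans cy; rewrite (sym_connect_sym av_sym).
have /connectP[p0 p0P yl] := cxy; move: xy evy; rewrite yl.
case/shortenP: p0P => p pp up _ xy evy.
have /andP[pe vp] := path_avoid _ _ _ (nev _ evx) pp.
have sz : (3 <= size (v :: x :: p))%N by case: (p) xy => //=; rewrite eqxx.
apply: (negP (e_acyc _ sz)).
rewrite /ucycleb /cycle /= evx rcons_path pe e_sym evy /=.
by move: vp up; rewrite /= => -> /andP[-> ->].
Qed.

(** Let [b] be an end at least as far from the root as the other. Its parent and the other end are
    both neighbours no farther than [b], so [lower_unique] identifies them. *)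
Lemma root_tree_edge x y :
  e x y = (x != w) && (root_parent x == y) || (y != w) && (root_parent y == x).
Proof.
have half a b : e a b -> (root_dist a <= root_dist b)%N -> (b != w) && (root_parent b == a).
  move=> eab dab; have [bw|bw] := eqVneq b w.
    rewrite bw dist_root leqn0 in dab.
    have [p [_ la /eqP]] := dist_path a; rewrite (eqP dab) size_eq0 => /eqP p0.
    by rewrite p0 /= in la; rewrite bw -la e_irr in eab.
  have [eb db] := parentP b bw; apply/eqP.
  by apply: (lower_unique b) => //; rewrite ?db // e_sym.
apply/idP/idP => [exy|/orP[]/andP[h /eqP<-]].
- case/orP: (leq_total (root_dist x) (root_dist y)) => h.
    by rewrite (half x y) ?orbT.
  by rewrite (half y x) // e_sym.
- by case: (parentP x h).
- by rewrite e_sym; case: (parentP y h).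
Qed.

Lemma root_tree_depth x : x != w -> root_dist x = (root_dist (root_parent x)).+1.
Proof. by case/parentP. Qed.

Lemma root_tree_root : root_dist w = 0%N.
Proof. exact: dist_root. Qed.

End RootTree.

(** * The numerical count *)

(** Here [m] is n - D, [r] counts the root's children that have children, [d0] the rest of depth
    class 1 beyond the root's children, [c1] and [c2] are the sizes of classes 2 and 0, [z] counts
    the centres of class 0, and [b] tells whether the root has a leaf child. Large [f] is settled by
    adding the bounds, small [f] by integrality. *)
Lemma counting_bound (R : realFieldType) (f : R) (m r d0 c1 c2 u1 t u2 s z : nat) (b : bool) :
  1 <= f -> 4 * d0%:R <= f ^+ 2 ->
  (c1 <= u1 + t)%N -> 4 * u1%:R <= f ^+ 2 -> 4 * t%:R <= f ^+ 2 + 2 * f ->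
  (c2 <= u2 + s)%N -> 4 * u2%:R <= f ^+ 2 -> 4 * s%:R <= f ^+ 2 ->
  (c2 <= z * s)%N -> (z + b)%N%:R <= f -> r%:R <= f -> (r <= c1)%N ->
  (m <= r + d0 + c1 + c2 + b)%N \/ (m <= 1)%N ->
  m%:R <= 2 * f ^+ 2.
Proof.
move=> f1 h0 hc1 hu1 ht hc2 hu2 hs hz hzb hr hrc hm.
have ff : f ^+ 2 = f * f by rewrite expr2.
rewrite ff in h0 hu1 ht hu2 hs *.
have m1 : (m <= 1)%N -> m%:R <= 2 * (f * f).
  by rewrite -(ler_nat R) => h; apply: le_trans h _; nra.
case: hm => [hm|/m1//].
have lt_nat (x : nat) (k : nat) (B : R) : x%:R <= B -> B < k%:R -> (x < k)%N.
  by move=> h1 h2; rewrite -(ltr_nat R); apply: le_lt_trans h1 h2.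
have b1 : (b <= 1)%N by case: (b).
(* The bounds add up to 1 + 3 f / 2 + 5 f^2 / 4, which is at most 2 f^2 from f = 1 + sqrt (7/3) on,
   just below 2.53. *)
have [fb|fs] := lerP (253 / 100) f.
  have : (m <= 1 + r + d0 + (u1 + t) + (u2 + s))%N.
    by clear - hm hc1 hc2 b1; lia.
  rewrite -(ler_nat R) !natrD; nra.
have ff1 : f * f <= 641 / 100 by nra.
have d0b : (d0 < 2)%N by apply: (lt_nat _ _ (641 / 400)); lra.
have u1b : (u1 < 2)%N by apply: (lt_nat _ _ (641 / 400)); lra.
have u2b : (u2 < 2)%N by apply: (lt_nat _ _ (641 / 400)); lra.
have sb : (s < 2)%N by apply: (lt_nat _ _ (641 / 400)); lra.
have tb : (t < 3)%N by apply: (lt_nat _ _ (1147 / 400)); lra.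
have zb : (z + b < 3)%N by apply: (lt_nat _ _ (253 / 100)); lra.
have rb : (r < 3)%N by apply: (lt_nat _ _ (253 / 100)); lra.
have c2z : (c2 <= z)%N.
  by apply: leq_trans hz _; rewrite -[leqRHS]muln1 leq_mul // -ltnS.
(* For f >= 2 the integer bounds give m <= 2 + 1 + 3 + 2 = 8 = 2 * 2^2. *)
have [f2|f2] := lerP 2 f.
  have : (m <= 8)%N by clear - hm hc1 d0b u1b tb zb rb c2z; lia.
  by rewrite -(ler_nat R) => h; apply: le_trans h _; nra.
have ff2 : f * f < 4 by nra.
have d00 : (d0 < 1)%N by apply: (lt_nat _ _ (f * f / 4)); lra.
have u10 : (u1 < 1)%N by apply: (lt_nat _ _ (f * f / 4)); lra.
have u20 : (u2 < 1)%N by apply: (lt_nat _ _ (f * f / 4)); lra.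
have s0 : (s < 1)%N by apply: (lt_nat _ _ (f * f / 4)); lra.
have t0 : (t < 2)%N by apply: (lt_nat _ _ ((f * f + 2 * f) / 4)); lra.
have [c10|c10] := posnP c1; first by apply: m1; clear - hm hrc c10 hc2 d00 u20 s0 b1; lia.
have t1 : t = 1%N by clear - c10 hc1 u10 t0; lia.
have m3 : (m <= 3)%N by clear - hm hrc hc1 hc2 d00 u10 u20 s0 t0 b1; lia.
(* With t = 1, 4 <= f^2 + 2 f forces f >= sqrt 5 - 1, whose doubled square exceeds 3; 1.225 lies
   just above sqrt (3/2). *)
rewrite t1 in ht; move: m3; rewrite -(ler_nat R) => m3.
apply: le_trans m3 _; rewrite leNgt; apply/negP => h.
have : f <= 1225 / 1000 by nra.
by move=> f3; lra.
Qed.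

Section FinalCount.
Variables (n : nat) (e : rel 'I_n) (w : 'I_n) (par : 'I_n -> 'I_n) (dep : 'I_n -> nat).
Hypothesis n_gt0 : (0 < n)%N.
Hypothesis eE : forall x y,
  e x y = (x != w) && (par x == y) || (y != w) && (par y == x).
Hypothesis depS : forall x, x != w -> dep x = (dep (par x)).+1.
Hypothesis dep0 : dep w = 0%N.
Hypothesis degree_max : forall c, (degree e c <= degree e w)%N.

Let children := children _ w par.
Let cls := depth_class _ w dep.
Let leaves := leaf_children _ w par.

(** A nonroot vertex spends one neighbour on its parent, hence the strict inequality. *)
Lemma root_children_max c : c != w -> (#|children c| < #|children w|)%N.
Proof.
move=> cw; have := degree_max c.
by rewrite (degree_root _ _ _ _ eE) (degree_nonroot _ _ _ _ _ eE depS).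
Qed.

Lemma leaf_nbr_le u : (#|[set x | e u x && is_leaf e x]| <= maxLeafNbr e)%N.
Proof. exact: (leq_bigmax (F := fun u => #|[set x | e u x && is_leaf e x]|)). Qed.

Lemma childless_leaf x : x != w -> children x = set0 -> is_leaf e x.
Proof.
by move=> xw x0; rewrite /is_leaf (degree_nonroot _ _ _ _ _ eE depS) // -/(children x) x0 cards0.
Qed.

Lemma leaf_children_le : (#|leaves| <= maxLeafNbr e)%N.
Proof.
apply: leq_trans (leaf_nbr_le w); apply/subset_leq_card/subsetP => x.
rewrite inE in_children => /andP[/andP[xw /eqP pw] /eqP x0].
by rewrite inE eE xw pw !eqxx orbT childless_leaf.
Qed.

(** A deepest vertex is a leaf unless it is the root. *)
Lemma has_leaf_or_trivial : (0 < maxLeafNbr e)%N \/ (n <= 1)%N.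
Proof.
have [x _ xmax] := @arg_maxnP _ w xpredT dep isT.
have [xw|xw] := eqVneq x w.
  right; have h i : #|depth_class _ w dep i| = 0%N.
    apply/eqP; rewrite cards_eq0; apply/eqP/setP => y; rewrite !inE.
    apply/negP => /andP[yw _].
    have : (dep y <= dep x)%N := xmax y isT.
    by rewrite xw dep0 depS.
  by have E := rooted_order _ w dep; rewrite !h in E; rewrite E.
left; apply: leq_trans (leaf_nbr_le (par x)); apply/card_gt0P; exists x.
rewrite inE eE xw eqxx orbT /= childless_leaf //.
apply/setP => y; rewrite in_children in_set0; apply/negP => /andP[yw /eqP yx].
have : (dep y <= dep x)%N := xmax y isT.
by rewrite depS // yx ltnn.
Qed.

Lemma rooted_excess_bound : (n - maxLeafNbr e)%N%:R <= 2 * excess _ e ^+ 2.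
Proof.
set f := excess _ e.
have rm := root_children_max.
have f1 : 1 <= f := excess_ge1 _ _ _ _ _ n_gt0 eE depS.
have b1 := depth1_bound _ _ _ _ _ n_gt0 eE depS dep0 rm.
have [u1 [t [hc1 hu1 ht]]] := depth2_bound _ _ _ _ _ n_gt0 eE depS dep0 rm.
have [u2 [s [hc2 hu2 hs hz]]] := depth0_bound _ _ _ _ _ n_gt0 eE depS dep0 rm.
have [hr hrc] := branch_children_bound _ _ _ _ _ n_gt0 eE depS dep0.
have hzb := depth0_centres_bound _ _ _ _ _ n_gt0 eE depS dep0.
have fR : f \is Num.real := excess_real _ e.
(* The order on [algC] is partial, so the arithmetic is carried out in its real subfield [algR]. *)
pose g := in_algR fR.
have leR (x y : algR) : (x <= y) = (algRval x <= algRval y) by [].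
have mE := (rmorphD algRval, rmorphM algRval, rmorphXn algRval, rmorph_nat algRval).
suff: (n - maxLeafNbr e)%N%:R <= 2 * g ^+ 2 :> algR by rewrite leR !mE.
have cls1 : #|cls 1| = (#|cls 1| - #|children w| + #|children w|)%N.
  rewrite subnK // subset_leq_card //; apply/subsetP => x xw; rewrite inE.
  have := dep_child _ _ _ _ depS dep0 x xw; move: xw.
  by rewrite in_children => /andP[-> _] ->.
have lsub : leaves \subset children w by apply/subsetP => x; rewrite inE => /andP[].
have chw : #|children w| = (#|children w :\: leaves| + #|leaves|)%N.
  by rewrite -(cardsID leaves (children w)) (setIidPr lsub) addnC.
apply: (@counting_bound _ g _ #|children w :\: leaves| (#|cls 1| - #|children w|)
  #|cls 2| #|cls 0| u1 t u2 s #|par @: cls 0| (0 < #|leaves|)%N) => //;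
  rewrite ?leR ?mE //.
have [D0|n1] := has_leaf_or_trivial; last by right; rewrite leq_subLR (leq_trans n1) // leq_addl.
(* The root adds 1 to n: this is [b] when the root has a leaf child, and otherwise it is absorbed by
   D > 0. *)
left; have := leaf_children_le; have := rooted_order _ w dep; rewrite -/(cls 0) -/(cls 1) -/(cls 2).
move: cls1 chw D0.
move: #|cls 0| #|cls 1| #|cls 2| #|children w| #|_ :\: _| #|leaves| (maxLeafNbr e).
by move=> c0 c1 c2 cw r [|a] D /=; lia.
Qed.

Lemma seidel_energy_of_excess (m : nat) : m%:R <= 2 * excess _ e ^+ 2 ->
  2 * n%:R - 6 + sqrtC (2 * m%:R) <= seidel_energy e.
Proof.
set f := excess _ e => h.
have f0 : 0 <= f := le_trans ler01 (excess_ge1 _ _ _ _ _ n_gt0 eE depS).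
have -> : seidel_energy e = 2 * n%:R - 6 + 2 * f.
  by rewrite /f /excess; field.
rewrite lerD2l -(@ler_pXn2r _ 2) ?nnegrE ?sqrtC_ge0 ?mulr_ge0 //.
rewrite sqrtCK exprMn -[2 ^+ 2]/(2 * 2) -mulrA ler_wpM2l //.
Qed.

End FinalCount.

Theorem theorem1 (n : nat) (e : rel 'I_n) :
  is_tree e ->
  2 * n%:R - 6 + sqrtC (2 * (n%:R - (maxLeafNbr e)%:R)) <= seidel_energy e.
Proof.
move=> [[e_irr e_sym] n_gt0 e_conn e_acyc].
have [w _ wmax] := @arg_maxnP _ (Ordinal n_gt0) xpredT (degree e) isT.
have eE := root_tree_edge _ e w e_irr e_sym e_conn e_acyc.
have depS := root_tree_depth _ e w e_sym e_conn.
have dep0 := root_tree_root _ e w e_conn.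
have h := rooted_excess_bound _ _ _ _ _ n_gt0 eE depS dep0 (fun c => wmax c isT).
have Dn : (maxLeafNbr e <= n)%N.
  by apply/bigmax_leqP => x _; rewrite -[leqRHS]card_ord max_card.
rewrite -natrB //.
exact: seidel_energy_of_excess _ _ _ _ _ n_gt0 eE depS _ h.
Qed.
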